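(* Let $\mathcal V,\mathcal W\subseteq L^2(\mathbb R^k)$ be FSI subspaces such that $\mathcal V\oplus\mathcal W^\perp=L^2(\mathbb R^k)$. Then the aliasing norm $A(\mathcal V,\mathcal W)=\|P_{\mathcal W//\mathcal V^\perp}P_{\mathcal W^\perp}\|$ satisfies $$A(\mathcal V,\mathcal W)=\tan([\mathcal V,\mathcal W]^a).$$
   Context: A closed subspace of $L^2(\mathbb R^k)$ is finitely generated shift-invariant (FSI) if it is the closed linear span of the integer translates $\{T_mf:f\in\mathcal A,m\in\mathbb Z^k\}$, $T_mf(x)=f(x-m)$, of a finite set $\mathcal A\subset L^2(\mathbb R^k)$. $\oplus$ denotes algebraic direct sum (sum equal to the whole space, trivial intersection); $\mathcal V\oplus\mathcal W^\perp=L^2(\mathbb R^k)$ is equivalent to $\mathcal W\oplus\mathcal V^\perp=L^2(\mathbb R^k)$. $P_{\mathcal W//\mathcal V^\perp}$ is the bounded oblique projection with range $\mathcal W$ and null space $\mathcal V^\perp$; $P_{\mathcal S}$ is the orthogonal projection onto $\mathcal S$. The aliasing norm is equivalently $A(\mathcal V,\mathcal W)=\sup_{0\ne e\in\mathcal W^\perp}\|P_{\mathcal W//\mathcal V^\perp}e\|/\|e\|$. Aperture: for closed subspaces $\mathcal S,\mathcal T$, $[\mathcal S,\mathcal T]^a\in[0,\pi/2]$ is the angle with $\cos([\mathcal S,\mathcal T]^a)=\inf\{\|P_{\mathcal S}f\|:f\in\mathcal T,\|f\|=1\}$ (taken to be the angle $0$ if $\mathcal T=\{0\}$). *)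

(* Defs.v *)
From HB Require Import structures.
From mathcomp Require Import all_boot all_order all_algebra.
From mathcomp Require Import complex.
From mathcomp Require Import all_classical all_reals all_analysis.

Set Implicit Arguments.
Unset Strict Implicit.
Unset Printing Implicit Defensive.

Import Order.TTheory GRing.Theory Num.Theory.
Import numFieldNormedType.Exports.

Local Open Scope classical_set_scope.
Local Open Scope complex_scope.
Local Open Scope ring_scope.

(* The sigma-algebra is the product of the Borel sigma-algebras. *)
Notation Rk R k := (k.-tuple (measurableTypeR R)).

Section cons_measure.
Context (R : realType) (n : nat).

Definition cons_pair (p : measurableTypeR R * Rk R n) : Rk R n.+1 :=
  [tuple of p.1 :: p.2].

Lemma measurable_cons_pair : measurable_fun setT cons_pair.
Proof. exact: measurable_cons. Qed.

HB.instance Definition _ :=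
  isMeasurableFun.Build _ _ _ _ cons_pair measurable_cons_pair.

Definition uncons_pair (t : Rk R n.+1) : measurableTypeR R * Rk R n :=
  (thead t, [tuple of behead t]).

Lemma measurable_uncons_pair : measurable_fun setT uncons_pair.
Proof.
apply/measurable_fun_pairP; split; first exact: measurable_tnth.
exact: measurable_behead.
Qed.

Lemma cons_pairK : cancel cons_pair uncons_pair.
Proof. by move=> [x t]; congr pair; apply: val_inj. Qed.

Variable mu : {sigma_finite_measure set (Rk R n) -> \bar R}.

Definition cons_measure : set (Rk R n.+1) -> \bar R :=
  pushforward (lebesgue_measure \x mu)%E cons_pair.

Let cons_measure0 : cons_measure set0 = 0%E.
Proof. exact: measure0. Qed.

Let cons_measure_ge0 A : (0 <= cons_measure A)%E.
Proof. exact: measure_ge0. Qed.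

Let cons_measure_sigma_additive : semi_sigma_additive cons_measure.
Proof. exact: measure_semi_sigma_additive. Qed.

HB.instance Definition _ := isMeasure.Build _ _ _ cons_measure
  cons_measure0 cons_measure_ge0 cons_measure_sigma_additive.

Let cons_measure_sigma_finite : sigma_finite setT cons_measure.
Proof.
have /sigma_finiteP[F [TF ndF Foo]] := sigma_finiteT (@lebesgue_measure R).
have /sigma_finiteP[G [TG ndG Goo]] := sigma_finiteT mu.
exists (fun i => uncons_pair @^-1` (F i `*` G i)) => [|i].
  apply/seteqP; split=> // t _.
  have [i _ Fi] : (\bigcup_i F i) (thead t) by rewrite -TF.
  have [j _ Gj] : (\bigcup_i G i) [tuple of behead t] by rewrite -TG.
  exists (maxn i j) => //; split.
    by move: Fi; exact/subsetPset/ndF/leq_maxl.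
  by move: Gj; exact/subsetPset/ndG/leq_maxr.
have [mF Fi] := Foo i; have [mG Gi] := Goo i; split.
  rewrite -[X in measurable X]setTI; apply: measurable_uncons_pair => //.
  exact: measurableX.
rewrite /cons_measure /pushforward (_ : _ @^-1` _ = F i `*` G i).
  by rewrite product_measure1E// lte_mul_pinfty// ge0_fin_numE.
by apply/funext => p; rewrite -[in RHS](cons_pairK p).
Qed.

HB.instance Definition _ :=
  Measure_isSigmaFinite.Build _ _ _ cons_measure cons_measure_sigma_finite.

End cons_measure.

(* Lebesgue measure on R^k, as the k-fold product of the one on R. *)
Fixpoint lebesgue_Rk (R : realType) (k : nat) :
    {sigma_finite_measure set (Rk R k) -> \bar R} :=
  match k with
  | 0 => \d_[tuple]
  | n.+1 => cons_measure (lebesgue_Rk R n)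
  end.

Lemma lebesgue_Rk_box (R : realType) (k : nat) (a b : 'I_k -> R) :
  (forall i, a i <= b i) ->
  lebesgue_Rk R k [set x | forall i, `[a i, b i]%classic (tnth x i)] =
  (\prod_(i < k) (b i - a i))%:E.
Proof.
elim: k a b => [|k IH] a b ab.
  rewrite big_ord0 /= diracE mem_set//=; by case.
rewrite big_ord_recl EFinM /= /cons_measure /pushforward.
set B := [set x | forall i : 'I_k,
  `[a (lift ord0 i), b (lift ord0 i)]%classic (tnth x i)].
have mB : measurable (B : set (Rk R k)).
  rewrite (_ : B = \bigcap_(i in [set: 'I_k])
      ((fun x : Rk R k => tnth x i) @^-1`
        `[a (lift ord0 i), b (lift ord0 i)]%classic)).
    apply: fin_bigcap_measurable => //= i _.
    by rewrite -[X in measurable X]setTI; apply: measurable_tnth.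
  by apply/seteqP; split=> x /= h i => [_|]; [exact: h|exact: (h i I)].
rewrite (_ : _ @^-1` _ = `[a ord0, b ord0]%classic `*` B).
  rewrite product_measure1E//; congr (_ * _)%E; last by rewrite IH.
  have := @lebesgue_measure_itv R `[a ord0, b ord0]; rewrite /= lte_fin => ->.
  rewrite -EFinB.
  have := ab ord0; rewrite le_eqVlt => /orP[/eqP->|->//].
  by rewrite ltxx subrr.
apply/seteqP; split=> -[x t] /= h.
  split; first by have := h ord0; rewrite tnth0.
  by move=> i; have := h (lift ord0 i); rewrite tnthS.
move=> i; case: (unliftP ord0 i) => [j ->|->]; last by rewrite tnth0; case: h.
by rewrite tnthS; case: h => _; exact.
Qed.

Section L2.
Context (R : realType) (k : nat).

(* The elements of L^2(R^k) are handled as square-integrable functions, up to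
   almost-everywhere equality.  The subspaces below (orthogonal complements,
   closed spans) are unions of classes: they are stable under a.e. equality
   among square-integrable functions. *)
Local Notation mu := (lebesgue_Rk R k).
Local Notation fct := (Rk R k -> R[i]).
Implicit Types (f g h : fct) (S N G V W : set fct).

Definition L2 : set fct := [set f |
  (fun x => complex.Re (f x)) \in Lfun mu 2%:E /\
  (fun x => complex.Im (f x)) \in Lfun mu 2%:E].

Definition l2norm f : \bar R :=
  'N[mu]_2%:E[(fun x => (ComplexField.Normc.normc (f x))%:E)]%E.

Definition l2dot f g : R[i] :=
  let h := fun x => f x * conjc (g x) in
  (\int[mu]_x complex.Re (h x))%R +i* (\int[mu]_x complex.Im (h x))%R.

Definition orthocompl S : set fct :=
  [set f | L2 f /\ forall g, S g -> l2dot f g = 0].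

Definition translate (m : k.-tuple int) f : fct :=
  fun x => f [tuple (tnth x i : R) - (tnth m i)%:~R | i < k].

Definition linear_span G : set fct := [set f |
  exists n (c : 'I_n -> R[i]) (g : 'I_n -> fct),
    (forall i, G (g i)) /\ f = fun x => \sum_(i < n) c i * g i x].

Definition l2closure S : set fct := [set f |
  L2 f /\ forall e : R, 0 < e -> exists2 g, S g & (l2norm (f - g)%R < e%:E)%E].

Definition FSI V : Prop := exists A : set fct,
  [/\ finite_set A, A `<=` L2 &
      V = l2closure (linear_span
            [set h | exists f m, A f /\ h = translate m f])].

(* Algebraic direct sum V (+) W = L^2; equality in L^2 is a.e. equality. *)
Definition direct_sum_L2 V W : Prop :=
  (forall f, L2 f -> exists v w, [/\ V v, W w & f = v + w %[ae mu]]) /\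
  (forall f, V f -> W f -> f = 0 %[ae mu]).

(* The projection with range S and null space N: the S-component of f in the
   decomposition L^2 = S (+) N. *)
Definition oblique_proj S N f : fct :=
  xget (0 : fct) [set g | S g /\ N (f - g)].

Definition orth_proj S : fct -> fct := oblique_proj S (orthocompl S).

Definition opnorm (T : fct -> fct) : \bar R :=
  ereal_sup [set l2norm (T f) | f in [set f | L2 f /\ (l2norm f <= 1)%E]].

Definition aliasing_norm V W : \bar R :=
  opnorm (oblique_proj W (orthocompl V) \o orth_proj (orthocompl W)).

(* The aperture [S, T]^a; the infimum lies in [0, 1], so that acos returns the
   angle of [0, pi/2] with that cosine. *)
Definition aperture S T : R :=
  if `[< forall f, T f -> f = 0 %[ae mu] >] then 0
  else acos (fine (ereal_inf
    [set l2norm (orth_proj S f) | f in [set f | T f /\ l2norm f = 1%E]])).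

End L2.

(* Main.v *)
(* Let P be the orthogonal projection onto V restricted to W. A gliding hump
   argument shows that V (+) W^perp = L^2 forces a lower bound c > 0 for P on the
   unit sphere of W; hence the range of P is closed, so L^2 = W + V^perp, and
   c = cos [V, W]^a may be taken optimal.
   For e in W^perp write e = w + v' with w in W and v' in V^perp. Then
   |v'|^2 = |w|^2 + |e|^2 and |w|^2 = - <w, v'> = - <w - P w, v'>, where
   |w - P w|^2 <= (1 - c^2) |w|^2; this gives |w| <= (sqrt (1 - c^2) / c) |e|.
   Conversely, for a unit vector w of W nearly minimizing |P w|, the vector
   v' = w - P w of V^perp is nearly optimal.
   Since V and W are complex subspaces, orthogonality for Re <f, g> is the same
   as for <f, g>, and L^2(R^k; C) may be viewed as the real space L^2 x L^2.
   Completeness is needed only along sequences with |u_m - u_n|^2 <= 8^-n,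
   m >= n. *)
Require Import Defs.
From mathcomp Require Import all_boot all_order all_algebra.
From mathcomp Require Import complex.
From mathcomp Require Import all_classical all_reals all_analysis.
From mathcomp Require Import measurable_realfun ring lra.

Set Implicit Arguments.
Unset Strict Implicit.
Unset Printing Implicit Defensive.

Import Order.TTheory GRing.Theory Num.Theory.
Import numFieldNormedType.Exports.

Local Open Scope classical_set_scope.
Local Open Scope ring_scope.

(** * Real Hilbert spaces, up to null vectors *)

(** [dot] is only semidefinite: vectors will be functions rather than classes, so a nonzero function
    vanishing almost everywhere is a null vector. *)
Record semiHilbert (R : realType) (E : lmodType R) := SemiHilbert {
  dot : E -> E -> R;
  dotC : forall x y, dot x y = dot y x;
  dotPl : forall a x y z, dot (a *: x + y) z = a * dot x z + dot y z;
  dot_ge0 : forall x, 0 <= dot x x;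
  dot_cvg : forall u : nat -> E,
    (forall n m, (n <= m)%N -> dot (u m - u n) (u m - u n) <= 8^-1 ^+ n) ->
    exists l, dot (l - u n) (l - u n) @[n --> \oo] --> 0 }.

Section SemiHilbertTheory.
Context (R : realType) (E : lmodType R) (H : semiHilbert E).
Local Notation "<< x , y >>" := (dot H x y) (at level 0, x, y at level 99).
Implicit Types (x y z : E) (S V W : set E).

Definition nrm x := Num.sqrt << x, x >>.

Lemma dotDl x y z : << x + y, z >> = << x, z >> + << y, z >>.
Proof. by rewrite -[x in LHS]scale1r dotPl mul1r. Qed.
Lemma dot0l z : << 0, z >> = 0.
Proof. by apply: (addrI << 0, z >>); rewrite -dotDl !addr0. Qed.
Lemma dotZl a x z : << a *: x, z >> = a * << x, z >>.
Proof. by rewrite -[a *: x]addr0 dotPl dot0l addr0. Qed.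
Lemma dotNl x z : << - x, z >> = - << x, z >>.
Proof. by rewrite -scaleN1r dotZl mulN1r. Qed.
Lemma dotBl x y z : << x - y, z >> = << x, z >> - << y, z >>.
Proof. by rewrite dotDl dotNl. Qed.
Lemma dotDr x y z : << z, x + y >> = << z, x >> + << z, y >>.
Proof. by rewrite !(dotC _ z) dotDl. Qed.
Lemma dotZr a x z : << z, a *: x >> = a * << z, x >>.
Proof. by rewrite !(dotC _ z) dotZl. Qed.
Lemma dotNr x z : << z, - x >> = - << z, x >>.
Proof. by rewrite !(dotC _ z) dotNl. Qed.
Lemma dotBr x y z : << z, x - y >> = << z, x >> - << z, y >>.
Proof. by rewrite !(dotC _ z) dotBl. Qed.

Lemma nrm_ge0 x : 0 <= nrm x. Proof. exact: sqrtr_ge0. Qed.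
Lemma nrm2 x : nrm x ^+ 2 = << x, x >>.
Proof. exact/sqr_sqrtr/dot_ge0. Qed.
Lemma nrmN x : nrm (- x) = nrm x.
Proof. by rewrite /nrm dotNl dotNr opprK. Qed.
Lemma nrmB x y : nrm (x - y) = nrm (y - x).
Proof. by rewrite -nrmN opprB. Qed.
Lemma nrmZ a x : nrm (a *: x) = `|a| * nrm x.
Proof. by rewrite /nrm dotZl dotZr mulrA -expr2 sqrtrM ?sqr_ge0// sqrtr_sqr. Qed.
Lemma nrm0 : nrm 0 = 0. Proof. by rewrite /nrm dot0l sqrtr0. Qed.

(** Otherwise the square of [t *: x + y] would be a nonconstant affine function of [t], hence
    negative somewhere. *)
Lemma dot_eq0l x y : nrm x = 0 -> << x, y >> = 0.
Proof.
move=> x0; have xx : << x, x >> = 0 by rewrite -nrm2 x0 expr0n.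
have [//|xy] := eqVneq << x, y >> 0.
(* This [t] gives [t *: x + y] the square -1. *)
pose t := - (<< y, y >> + 1) / (2 * << x, y >>).
have := dot_ge0 H (t *: x + y).
rewrite !(dotDl, dotDr, dotZl, dotZr) (dotC H y x) xx !mulr0 add0r.
have -> : t * << x, y >> = - (<< y, y >> + 1) / 2 by rewrite /t; field.
by lra.
Qed.

(** Cauchy-Schwarz: [y] minus its component along [x] has nonnegative square. For a null [x] that
    component cannot be formed, and [dot_eq0l] takes over. *)
Lemma normr_dot_le x y : `|<< x, y >>| <= nrm x * nrm y.
Proof.
have [x0|x0] := eqVneq (nrm x) 0; first by rewrite (dot_eq0l _ x0) x0 mul0r normr0.
have xgt0 : 0 < nrm x by rewrite lt_def x0 nrm_ge0.
rewrite -(@ler_pXn2r _ 2) ?nnegrE ?mulr_ge0 ?nrm_ge0//.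
rewrite real_normK ?num_real// exprMn.
have := dot_ge0 H (- (<< x, y >> / nrm x ^+ 2) *: x + y).
rewrite !(dotDl, dotDr, dotZl, dotZr) (dotC H y x) -!nrm2.
have : << x, y >> / nrm x ^+ 2 * nrm x ^+ 2 = << x, y >>.
  by rewrite divfK// expf_neq0.
set q := _ / _ => qx.
rewrite -(ler_pM2r (exprn_gt0 2 xgt0)) mul0r.
by nra.
Qed.

Lemma dot_le x y : << x, y >> <= nrm x * nrm y.
Proof. exact: le_trans (ler_norm _) (normr_dot_le _ _). Qed.

Lemma nrmD x y : nrm (x + y) <= nrm x + nrm y.
Proof.
rewrite -(@ler_pXn2r _ 2) ?nnegrE ?addr_ge0 ?nrm_ge0//.
rewrite nrm2 dotDl !dotDr (dotC H y x) -!nrm2.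
by have := dot_le x y; nra.
Qed.

Lemma nrm_triangle y x z : nrm (x - z) <= nrm (x - y) + nrm (y - z).
Proof. by have := nrmD (x - y) (y - z); rewrite addrA subrK. Qed.

Lemma pythagoras x y : << x, y >> = 0 -> nrm (x + y) ^+ 2 = nrm x ^+ 2 + nrm y ^+ 2.
Proof. by move=> xy; rewrite !nrm2 dotDl !dotDr (dotC H y x) xy addr0 add0r. Qed.

(** * Closed subspaces and orthogonal complements *)

Definition orth S : set E := [set x | forall y, S y -> << x, y >> = 0].

Definition closed_subspace S := [/\ S 0,
  forall a x y, S x -> S y -> S (a *: x + y) &
  forall x, (forall e, 0 < e -> exists2 y, S y & nrm (x - y) < e) -> S x].

Section closed_subspace_lemmas.
Context (S : set E) (cS : closed_subspace S).

Lemma subspace0 : S 0. Proof. by case: cS. Qed.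
Lemma subspaceP a x y : S x -> S y -> S (a *: x + y).
Proof. by case: cS => _ + _; exact. Qed.
Lemma subspaceD x y : S x -> S y -> S (x + y).
Proof. by move=> Sx Sy; rewrite -[x]scale1r; exact: subspaceP. Qed.
Lemma subspaceZ a x : S x -> S (a *: x).
Proof.
by move=> Sx; rewrite -[_ *: _]addr0; apply: subspaceP => //; exact: subspace0.
Qed.
Lemma subspaceN x : S x -> S (- x).
Proof. by rewrite -scaleN1r; exact: subspaceZ. Qed.
Lemma subspaceB x y : S x -> S y -> S (x - y).
Proof. by move=> Sx Sy; apply: subspaceD => //; exact: subspaceN. Qed.
Lemma subspace_closed x : (forall e, 0 < e -> exists2 y, S y & nrm (x - y) < e) -> S x.
Proof. by case: cS => _ _; exact. Qed.
(** A vector at distance 0 is a limit, so closed subspaces are unions of classes modulo null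
    vectors. *)
Lemma subspace_null x y : S y -> nrm (x - y) = 0 -> S x.
Proof. by move=> Sy xy; apply: subspace_closed => e e0; exists y => //; rewrite xy. Qed.
End closed_subspace_lemmas.

Lemma orth_closed_subspace S : closed_subspace (orth S).
Proof.
split=> [y _|a x y Sx Sy z Sz|x h y Sy]; [exact: dot0l| |].
  by rewrite dotPl Sx// Sy// mulr0 addr0.
apply/eqP; rewrite -normr_le0; apply/ler_addgt0Pl => e e0; rewrite addr0.
have y1 : 0 < nrm y + 1 by have := nrm_ge0 y; lra.
have [z Sz xz] := h (e / (nrm y + 1)) (divr_gt0 e0 y1).
rewrite -[x](subrK z) dotDl (Sz y)// addr0.
apply: (le_trans (normr_dot_le _ _)).
move: xz; rewrite ltr_pdivlMr//; have := nrm_ge0 (x - z); have := nrm_ge0 y; nra.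
Qed.

Lemma orth_self S x : S x -> orth S x -> nrm x = 0.
Proof. by move=> Sx /(_ x Sx); rewrite /nrm => ->; rewrite sqrtr0. Qed.

(** * Fast Cauchy sequences and the projection theorem *)

Lemma exprn_lt_small (q e : R) : 0 <= q < 1 -> 0 < e -> exists n, q ^+ n < e.
Proof.
move=> /andP[q0 q1] e0; have /cvgrPdist_lt : q ^+ n @[n --> \oo] --> (0 : R).
  by apply: cvg_expr; rewrite ger0_norm.
move=> /(_ e e0) [n _ /(_ n (leqnn n))] /=.
by rewrite sub0r normrN ger0_norm ?exprn_ge0// => h; exists n.
Qed.

Lemma expr8V_lt (e : R) : 0 < e -> exists n, 8^-1 ^+ n < e.
Proof. by apply: exprn_lt_small; lra. Qed.

Lemma normr_le_sqr (a b : R) : 0 <= b -> a ^+ 2 <= b ^+ 2 -> `|a| <= b.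
Proof.
by move=> b0; rewrite -[a ^+ 2]real_normK ?num_real// ler_pXn2r ?nnegrE.
Qed.

Lemma dist_lt (e : R) : 0 < e ->
  exists n, forall x, << x, x >> <= 8^-1 ^+ n -> nrm x < e.
Proof.
move=> e0; have [n ne] := expr8V_lt (exprn_gt0 2 e0).
exists n => x xn; rewrite -(@ltr_pXn2r _ 2) ?nnegrE ?nrm_ge0 ?(ltW e0)//.
by rewrite nrm2; exact: le_lt_trans xn ne.
Qed.

(** Evaluate at the vertex [t = b / c]. For [c = 0] the form is affine, and [t = (a + 1) / (2 * b)]
    would give -1. *)
Lemma quad_disc (a b c : R) :
  0 <= c -> (forall t, 0 <= a - 2 * t * b + t ^+ 2 * c) -> b ^+ 2 <= a * c.
Proof.
rewrite le_eqVlt => /predU1P[<-|c0] h.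
  have [->|b0] := eqVneq b 0; first by rewrite mulr0 expr0n.
  have := h ((a + 1) / (2 * b)).
  have -> : 2 * ((a + 1) / (2 * b)) * b = a + 1 by field.
  by lra.
have := h (b / c); have -> : a - 2 * (b / c) * b + (b / c) ^+ 2 * c = a - b ^+ 2 / c.
  by field; rewrite gt_eqF.
by rewrite subr_ge0 ler_pdivrMr.
Qed.

(** The rate survives in the limit: split [l - u n] at some [u m] with [m] large. *)
Lemma dot_complete (u : nat -> E) :
  (forall n m, (n <= m)%N -> << u m - u n, u m - u n >> <= 8^-1 ^+ n) ->
  exists l, forall n, << l - u n, l - u n >> <= 8^-1 ^+ n.
Proof.
move=> ucau; have [l ul] := dot_cvg ucau; exists l => n.
have r0 : 0 <= (8^-1 : R) ^+ n by rewrite exprn_ge0.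
rewrite -nrm2 -[leRHS]sqr_sqrtr// ler_pXn2r ?nnegrE ?nrm_ge0 ?sqrtr_ge0//.
apply/ler_addgt0Pl => e e0.
move/cvgrPdist_lt : ul => /(_ _ (exprn_gt0 2 e0))[N _ NP].
have := NP (maxn N n) (leq_maxl _ _); set m := maxn N n.
rewrite sub0r normrN ger0_norm ?dot_ge0// -nrm2 => lm.
apply: (le_trans (nrm_triangle (u m) _ _)); apply: lerD.
  by rewrite -(@ler_pXn2r _ 2) ?nnegrE ?nrm_ge0 ?(ltW e0)// ltW.
exact/ler_wsqrtr/ucau/leq_maxr.
Qed.

(** A minimizing sequence for the distance to [S] is Cauchy by the parallelogram law. Its members
    satisfy the orthogonality up to a small error, which vanishes in the limit. *)
Lemma projection S x : closed_subspace S -> exists2 y, S y & orth S (x - y).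
Proof.
move=> cS.
pose D := [set << x - y, x - y >> | y in S].
have D0 : D !=set0 by exists << x - 0, x - 0 >>, 0 => //; exact: subspace0.
have lbD : has_inf D.
  by split=> //; exists 0 => _ [y _ <-]; exact: dot_ge0.
pose d := inf D.
have dle y : S y -> d <= << x - y, x - y >>.
  by move=> Sy; apply: ge_inf; [exact: lbD.2|exists y].
(* With this excess over the minimum, the parallelogram bound is at most the rate [8^-1 ^+ n] that
   [dot_complete] asks for. *)
have e0 n : 0 < (8^-1 ^+ n / 4 : R) by rewrite divr_gt0// exprn_gt0//; lra.
have /choice[y yP] : forall n, exists y, S y /\ << x - y, x - y >> <= d + 8^-1 ^+ n / 4.
  move=> n; have [_ [y Sy <-] yd] := inf_adherent (e0 n) lbD.
  by exists y; split => //; exact: ltW.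
(* The midpoint of [y m] and [y n] lies in [S], hence at squared distance at least [d] from [x]. *)
have par n m : << y m - y n, y m - y n >> <=
    2 * (<< x - y m, x - y m >> + << x - y n, x - y n >>) - 4 * d.
  have := dle (2^-1 *: (y m + y n)); rewrite -[_ *: _]addr0.
  move=> /(_ (subspaceP cS _ (subspaceD cS (yP m).1 (yP n).1) (subspace0 cS))).
  rewrite addr0 !(dotBl, dotBr, dotDl, dotDr, dotZl, dotZr).
  rewrite !(dotC H x, dotC H (y n) (y m)).
  lra.
have [|l hl] := dot_complete (u := y).
  move=> n m nm; apply: (le_trans (par n m)).
  have := (yP n).2; have := (yP m).2.
  have : (8^-1 ^+ m <= 8^-1 ^+ n :> R) by apply: ler_wiXn2l => //; lra.
  lra.
have Sl : S l.
  apply: subspace_closed => // e {}e0; have [n hn] := dist_lt e0.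
  by exists (y n); [exact: (yP n).1|exact/hn/hl].
exists l => // z Sz.
(* Moving from [y n] along [z] lowers the squared distance by at most the excess, for every [t];
   take the discriminant. *)
have small n : << x - y n, z >> ^+ 2 <= 8^-1 ^+ n / 4 * << z, z >>.
  apply: quad_disc (dot_ge0 H z) _ => t.
  have := dle (t *: z + y n) (subspaceP cS _ Sz (yP n).1).
  have -> : x - (t *: z + y n) = (x - y n) - t *: z by rewrite opprD addrCA addrC.
  have := (yP n).2.
  rewrite !(dotBl _ (_ *: _)) !(dotBr _ (_ *: _)) !dotZl !dotZr (dotC H z (x - y n)).
  lra.
have z1 : 0 < nrm z + 1 by have := nrm_ge0 z; lra.
apply/eqP; rewrite -normr_le0; apply/ler_addgt0Pl => e ee0; rewrite addr0.
(* The errors [h1] and [h2] below are each at most [q * nrm z] with [q = e / (2 * (nrm z + 1))]. *)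
have [n hn] := expr8V_lt (exprn_gt0 2 (divr_gt0 ee0 (mulr_gt0 (ltr0n _ 2) z1))).
set q := e / _ in hn.
have q0 : 0 < q by rewrite divr_gt0// mulr_gt0.
have qe : q * (2 * (nrm z + 1)) = e by rewrite divfK// gt_eqF// mulr_gt0.
have h1 : `|<< x - y n, z >>| <= q * nrm z.
  apply: normr_le_sqr; first by rewrite mulr_ge0 ?nrm_ge0// ltW.
  rewrite exprMn (le_trans (small n))// nrm2.
  apply: ler_wpM2r; first exact: dot_ge0.
  have : 0 <= (8^-1 ^+ n : R) by rewrite exprn_ge0.
  by lra.
have h2 : `|<< y n - l, z >>| <= q * nrm z.
  apply: (le_trans (normr_dot_le _ _)); apply: ler_wpM2r; first exact: nrm_ge0.
  rewrite -(@ler_pXn2r _ 2) ?nnegrE ?nrm_ge0 ?(ltW q0)// nrmB nrm2.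
  exact: (le_trans (hl n) (ltW hn)).
have -> : x - l = (x - y n) + (y n - l) by rewrite addrA subrK.
rewrite dotDl; apply: (le_trans (ler_normD _ _)).
by rewrite -qe; lra.
Qed.

(** With [y] the projection of [x], the vector [x - y] is orthogonal to both [x] and [y], hence
    null. *)
Lemma orth_orth S x : closed_subspace S -> orth (orth S) x -> S x.
Proof.
move=> cS Sx; have [y Sy xy] := projection x cS.
apply: (subspace_null cS Sy); rewrite /nrm dotBl Sx//.
by rewrite dotC xy// subr0 sqrtr0.
Qed.

Lemma nrm_proj S x y : S y -> orth S (x - y) ->
  nrm x ^+ 2 = nrm y ^+ 2 + nrm (x - y) ^+ 2.
Proof. by move=> Sy Sxy; rewrite -pythagoras ?subrKC// dotC; exact: Sxy. Qed.

Lemma nrm_dist0 x y : nrm (x - y) = 0 -> nrm x = nrm y.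
Proof.
move=> xy; apply/eqP; rewrite eq_le; apply/andP; split.
  by have := nrmD (x - y) y; rewrite subrK xy add0r.
by have := nrmD (y - x) x; rewrite subrK nrmB xy add0r.
Qed.

(** Projections are determined only up to null vectors, which do not affect norms. *)
Lemma nrm_proj_unique S x y z : closed_subspace S -> S y -> S z ->
  orth S (x - y) -> orth S (x - z) -> nrm y = nrm z.
Proof.
move=> cS Sy Sz xy xz; apply/nrm_dist0/(orth_self (subspaceB cS Sy Sz)).
have -> : y - z = (x - z) - (x - y) by rewrite opprB [RHS]addrC subrKA.
exact: (subspaceB (orth_closed_subspace S)).
Qed.

(** * The decompositions V + W^perp and W + V^perp, and bounds for the oblique projection *)

Section oblique.
Context (V W : set E) (cV : closed_subspace V) (cW : closed_subspace W).
Context (VW_dec : forall x, exists2 v, V v & orth W (x - v)).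
Context (VW_cap : forall x, V x -> orth W x -> nrm x = 0).

(* A gliding hump: otherwise the unit vectors [w n] of W whose V-components are
   tiny allow one to build [l] for which the V-component in V + W^perp would be
   larger than any bound. *)
Lemma coercive : exists2 c : R, 0 < c &
  forall w p, W w -> V p -> orth V (w - p) -> c * nrm w <= nrm p.
Proof.
apply: contrapT => nc.
have /choice[wp wpP] n : exists wp : E * E, [/\ W wp.1, V wp.2, orth V (wp.1 - wp.2),
    nrm wp.1 = 1 & nrm wp.2 <= 16^-1 ^+ n.+1].
  apply: contrapT => nwp; apply: nc; exists (16^-1 ^+ n.+1); first by rewrite exprn_gt0.
  move=> w p Ww Vp wp; rewrite leNgt; apply/negP => pw.
  have w0 : 0 < nrm w.
    rewrite lt_def nrm_ge0 andbT; apply/eqP => w0.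
    by move: pw; rewrite w0 mulr0 ltNge nrm_ge0.
  apply: nwp; exists ((nrm w)^-1 *: w, (nrm w)^-1 *: p); split => /=.
  - exact: subspaceZ.
  - exact: subspaceZ.
  - by rewrite -scalerBr; exact: (subspaceZ (orth_closed_subspace V)).
  - by rewrite nrmZ ger0_norm ?invr_ge0 ?nrm_ge0// mulVf// gt_eqF.
  - rewrite nrmZ ger0_norm ?invr_ge0 ?nrm_ge0// ler_pdivrMl// mulrC.
    exact: ltW.
pose w n := (wp n).1.
have w1 n : nrm (w n) = 1 by have [] := wpP n.
(* Each weight exceeds the sum of all later ones, and [t n ^+ 2] is the bound [16^-1 ^+ n.+1] on the
   projections. *)
pose t n : R := 4^-1 ^+ n.+1.
have t0 n : 0 < t n by rewrite exprn_gt0.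
have tS n : t n.+1 = t n / 4 by rewrite /t exprSr.
(* The sign keeps the new term from cancelling against [<< f m, w m >>]. *)
pose fix f n := if n is m.+1 then
  f m + (if 0 <= << f m, w m >> then t m else - t m) *: w m else 0.
have fS n : nrm (f n.+1 - f n) = t n.
  by rewrite /= addrC addKr nrmZ w1 mulr1; case: ifP => _; rewrite ?normrN gtr0_norm.
have fw n : t n <= `|<< f n.+1, w n >>|.
  rewrite /= dotDl dotZl -nrm2 w1 expr1n mulr1.
  have := t0 n; case: (lerP 0 << f n, w n >>) => h tn.
    by rewrite ger0_norm ?addr_ge0 ?(ltW tn)// lerDr.
  by rewrite ltr0_norm; lra.
have fcau n m : (n <= m)%N -> nrm (f m - f n) <= 4 / 3 * (t n - t m).
  elim: m => [|m IH]; first by rewrite leqn0 => /eqP ->; rewrite !subrr mulr0 nrm0.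
  rewrite leq_eqVlt => /predU1P[->|]; first by rewrite !subrr mulr0 nrm0.
  rewrite ltnS => /IH {}IH.
  have := nrm_triangle (f m) (f m.+1) (f n); rewrite fS tS => h.
  by apply: (le_trans h); have := t0 m; lra.
have t3 n : (4 / 3 * t n) ^+ 2 <= 8^-1 ^+ n.
  have -> : (4 / 3 * t n) ^+ 2 = (4^-1 ^+ 2) ^+ n / 9.
    by rewrite /t (exprSr _ n) exprAC; move: (4^-1 ^+ n) => q; field.
  have : ((4^-1 : R) ^+ 2) ^+ n <= 8^-1 ^+ n by apply: lerXn2r; rewrite ?nnegrE; lra.
  have : 0 <= ((4^-1 : R) ^+ 2) ^+ n by rewrite exprn_ge0// exprn_ge0.
  by lra.
have [|l hl] := dot_complete (u := f) .
  move=> n m nm; rewrite -nrm2; apply: (le_trans _ (t3 n)).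
  rewrite ler_pXn2r ?nnegrE ?nrm_ge0//; last by have := t0 n; lra.
  by apply: (le_trans (fcau _ _ nm)); have := t0 m; lra.
have lf n : nrm (l - f n) <= 4 / 3 * t n.
  apply/ler_addgt0Pl => e e0; have [k hk] := dist_lt e0.
  apply: (le_trans (nrm_triangle (f (maxn n k)) _ _)); apply: lerD.
    apply/ltW/hk/(le_trans (hl _)); apply: ler_wiXn2l => //; first lra.
    exact: leq_maxr.
  by apply: (le_trans (fcau _ _ (leq_maxl n k))); have := t0 (maxn n k); lra.
have [v Vv lv] := VW_dec l.
(* [<< l, w n >>] has size at least [t n] minus the tail [4 / 3 * t n.+1], yet it equals
   [<< v, (wp n).2 >>], which is tiny. *)
have tv n : 2 / 3 * t n <= nrm v * 16^-1 ^+ n.+1.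
  have [Wn Vn on _ pn] := wpP n.
  have -> : 2 / 3 * t n = t n - 4 / 3 * t n.+1 by rewrite tS; lra.
  have lw : << l, w n >> = << v, (wp n).2 >>.
    rewrite -[l](subrK v) dotDl lv// add0r dotC -[w n](subrK (wp n).2).
    by rewrite dotDl on// add0r dotC.
  have : `|<< v, (wp n).2 >>| <= nrm v * 16^-1 ^+ n.+1.
    by apply: (le_trans (normr_dot_le _ _)); rewrite ler_wpM2l// nrm_ge0.
  apply: le_trans; rewrite -lw.
  have := ler_normD << f n.+1 - l, w n >> << l, w n >>; rewrite -dotDl subrK.
  have := normr_dot_le (f n.+1 - l) (w n); rewrite w1 mulr1 nrmB.
  by have := lf n.+1; have := fw n; lra.
have v1 : 0 < nrm v + 1 by have := nrm_ge0 v; lra.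
(* As [16^-1 ^+ n.+1 = t n * t n], the bound [tv] reads [2 / 3 <= nrm v * t n], false for large
   [n]. *)
have [||n] := @exprn_lt_small 4^-1 (2 / 3 / (nrm v + 1)); [lra|by rewrite divr_gt0|].
have -> : (4^-1 : R) ^+ n = t n * 4 by rewrite /t exprSr; field.
have := tv n; have -> : (16^-1 : R) ^+ n.+1 = t n * t n.
  by rewrite /t -exprMn; congr (_ ^+ _); field.
rewrite mulrA ler_pM2r// ltr_pdivlMr//.
by have := t0 n; have := nrm_ge0 v; nra.
Qed.

(** Coercivity makes [U], which is W + V^perp, closed. A vector orthogonal to [U] lies in V, the
    complement of V^perp, and in W^perp, so it is null. *)
Lemma dual_dec x : exists2 w, W w & orth V (x - w).
Proof.
have [c c0 cP] := coercive.
have coV := orth_closed_subspace V.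
pose U := [set x | exists2 w, W w & orth V (x - w)].
have cU : closed_subspace U.
  split.
  - by exists 0; [exact: subspace0|rewrite subrr; exact: (subspace0 coV)].
  - move=> a y z [v Wv yv] [w Ww zw]; exists (a *: v + w); first exact: subspaceP.
    by rewrite opprD addrACA -scalerBr; exact: (subspaceP coV).
  move=> {}x xP.
  pose r n : R := Num.sqrt (8^-1 ^+ n).
  have r2 n : r n ^+ 2 = 8^-1 ^+ n by rewrite sqr_sqrtr// exprn_ge0.
  have r0 n : 0 < r n by rewrite sqrtr_gt0 exprn_gt0.
  (* Two points within [c / 2 * r n] of [x] are at most [c * r n] apart; coercivity then leaves the
     rate [r n] for their W-components. *)
  have c2 : 0 < c / 2 by rewrite divr_gt0.
  have ex_yw n : exists yw : E * E,
      [/\ W yw.2, orth V (yw.1 - yw.2) & nrm (x - yw.1) < c / 2 * r n].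
    have [z [v Wv zv] xz] := xP (c / 2 * r n) (mulr_gt0 c2 (r0 n)).
    by exists (z, v).
  have /choice[yw ywP] := ex_yw.
  pose y n := (yw n).1; pose w n := (yw n).2.
  have Ww n : W (w n) by have [] := ywP n.
  have yw_orth n : orth V (y n - w n) by have [] := ywP n.
  have xy n : nrm (x - y n) < c / 2 * r n by have [] := ywP n.
  have r_le n m : (n <= m)%N -> r m <= r n.
    by move=> nm; rewrite ler_wsqrtr//; apply: ler_wiXn2l => //; lra.
  have w_cauchy n m : (n <= m)%N -> nrm (w m - w n) <= r n.
    move=> nm; have [p Vp yp] := projection (y m - y n) cV.
    (* [y m - y n] and [w m - w n] differ by a vector of V^perp, so they have the same projection on
       V. *)
    have wp : orth V (w m - w n - p).
      have -> : w m - w n - p = (y m - y n - p) - ((y m - w m) - (y n - w n)).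
        rewrite -{1}(subrK (w m) (y m)) -{1}(subrK (w n) (y n)).
        set a := y m - w m; set b := y n - w n.
        rewrite [in RHS]opprD [a + w m + _]addrACA.
        by rewrite -[X in _ = X - _]addrA [X in _ = X - _]addrC addrK.
      exact: (subspaceB coV yp (subspaceB coV (yw_orth m) (yw_orth n))).
    have cw := cP _ _ (subspaceB cW (Ww m) (Ww n)) Vp wp.
    have py : nrm p <= nrm (y m - y n).
      rewrite -(@ler_pXn2r _ 2) ?nnegrE ?nrm_ge0// (nrm_proj Vp yp).
      by rewrite lerDl sqr_ge0.
    have := nrm_triangle x (y m) (y n); rewrite (nrmB (y m) x).
    have := xy m; have := xy n; have := r_le _ _ nm => rr xn xm tri.
    by rewrite -(ler_pM2l c0); have := ler_wpM2l (ltW c2) rr; lra.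
  have [|l hl] := dot_complete (u := w) .
    move=> n m nm; rewrite -nrm2 -r2 ler_pXn2r ?nnegrE ?nrm_ge0 ?(ltW (r0 n))//.
    exact: w_cauchy.
  have Wl : W l.
    apply: subspace_closed => // e e0; have [n hn] := dist_lt e0.
    by exists (w n) => //; exact: hn.
  exists l => //; apply: subspace_closed => // e e0.
  (* The error is [c / 2 * r n] from [y n] plus [r n] from [w n]. *)
  have e1 : 0 < e / (c / 2 + 1) by rewrite divr_gt0// addr_gt0.
  have [n hn] := expr8V_lt (exprn_gt0 2 e1).
  have rn : r n * (c / 2 + 1) < e.
    rewrite -ltr_pdivlMr ?addr_gt0//.
    by rewrite -(@ltr_pXn2r _ 2) ?nnegrE ?(ltW (r0 n)) ?(ltW e1)// r2.
  exists (y n - w n) => //.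
  have -> : x - l - (y n - w n) = (x - y n) - (l - w n).
    by rewrite !opprD !opprK !addrA (addrAC x (- l)).
  have := nrmD (x - y n) (- (l - w n)); rewrite nrmN.
  have : nrm (l - w n) <= r n.
    by rewrite -(@ler_pXn2r _ 2) ?nnegrE ?nrm_ge0 ?(ltW (r0 n))// nrm2 r2.
  by have := xy n; lra.
have [u Uu xu] := projection x cU.
suff x_u : nrm (x - u) = 0 by have := subspace_null cU Uu x_u.
apply: VW_cap.
  apply: orth_orth => // y Vy; apply: xu; exists 0; first exact: subspace0.
  by rewrite subr0.
move=> y Wy; apply: xu; exists y => //; rewrite subrr.
exact: (subspace0 (orth_closed_subspace V)).
Qed.

(** For [c > 0] this is the bound [nrm w <= sqrt (1 - c ^+ 2) / c * nrm e], written without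
    division. *)
Lemma oblique_le (c : R) : c <= 1 ->
  (forall w p, W w -> V p -> orth V (w - p) -> c * nrm w <= nrm p) -> 0 <= c ->
  forall e w, orth W e -> W w -> orth V (e - w) ->
  c ^+ 2 * nrm w ^+ 2 <= (1 - c ^+ 2) * nrm e ^+ 2.
Proof.
move=> c1 cP c0 e w We Ww ew.
have [p Vp wp] := projection w cV.
have wv : << w, e - w >> = - nrm w ^+ 2 by rewrite dotBr (dotC H w e) We// sub0r nrm2.
have qv : << w, e - w >> = << w - p, e - w >>.
  by rewrite [RHS]dotBl (dotC H p) ew// subr0.
have v2 : nrm (e - w) ^+ 2 = nrm e ^+ 2 + nrm w ^+ 2.
  by rewrite pythagoras ?nrmN// dotNr We// oppr0.
have q2 := nrm_proj Vp wp.
have cw := cP _ _ Ww Vp wp.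
have : nrm w ^+ 2 <= nrm (w - p) * nrm (e - w).
  have := normr_dot_le (w - p) (e - w); rewrite -qv wv normrN ger0_norm//.
  exact: sqr_ge0.
have [->|w0] := eqVneq (nrm w) 0.
  by move=> _; rewrite expr0n mulr0 mulr_ge0 ?sqr_ge0// subr_ge0 expr_le1.
have {w0}w0 : 0 < nrm w by rewrite lt_def w0 nrm_ge0.
(* Squaring allows both factors to be replaced: [v2] for [e - w], and the bound [q2c] for [w - p]. A
   factor [nrm w ^+ 2] then cancels. *)
move=> h0; have h : (nrm w ^+ 2) ^+ 2 <= nrm (w - p) ^+ 2 * (nrm e ^+ 2 + nrm w ^+ 2).
  by rewrite -v2 -exprMn ler_pXn2r ?nnegrE ?mulr_ge0 ?sqr_ge0 ?nrm_ge0.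
have q2c : nrm (w - p) ^+ 2 <= (1 - c ^+ 2) * nrm w ^+ 2.
  have : (c * nrm w) ^+ 2 <= nrm p ^+ 2.
    by rewrite ler_pXn2r ?nnegrE ?mulr_ge0 ?nrm_ge0.
  by rewrite exprMn; lra.
have s0 : 0 <= nrm e ^+ 2 + nrm w ^+ 2 by rewrite addr_ge0 ?sqr_ge0.
have w2 : 0 < nrm w ^+ 2 by rewrite exprn_gt0.
have : nrm w ^+ 2 * nrm w ^+ 2 <=
    nrm w ^+ 2 * ((1 - c ^+ 2) * (nrm e ^+ 2 + nrm w ^+ 2)).
  by rewrite -expr2 mulrCA mulrA; exact: le_trans h (ler_wpM2r s0 q2c).
by rewrite ler_pM2l//; lra.
Qed.

(** Near-minimizers of the projection onto V yield test vectors of W^perp, which force any bound [M]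
    to be at least [sqrt (1 - c ^+ 2) / c] when [0 < c <= 1]. *)
Lemma oblique_sup (c M : R) : 0 <= c -> 0 <= M ->
  (forall e, 0 < e -> exists w p, [/\ W w, V p, orth V (w - p), nrm w = 1 &
    nrm p < c + e]) ->
  (forall e w, orth W e -> W w -> orth V (e - w) -> nrm w <= M * nrm e) ->
  1 <= (1 + M ^+ 2) * c ^+ 2.
Proof.
move=> c0 M0 cP MP.
have M1 : 0 < 1 + M ^+ 2 by have := sqr_ge0 M; lra.
(* Here [c] stands alone, so the error of the near-minimizer can tend to 0. *)
suff : Num.sqrt ((1 + M ^+ 2)^-1) <= c.
  move=> h; rewrite -ler_pdivrMl// mulr1.
  rewrite -(@sqr_sqrtr _ (1 + M ^+ 2)^-1) ?invr_ge0 ?(ltW M1)//.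
  by rewrite ler_pXn2r ?nnegrE ?sqrtr_ge0.
apply/ler_addgt0Pr => e e0.
have [w [p [Ww Vp wp w1 pe]]] := cP _ e0.
apply: le_trans (ltW pe).
have p0 := nrm_ge0 p.
rewrite -(@ler_pXn2r _ 2) ?nnegrE ?sqrtr_ge0// sqr_sqrtr ?invr_ge0 ?(ltW M1)//.
rewrite -div1r ler_pdivrMr//.
(* The test vector [w - p - w'] lies in W^perp, and its W-component along V^perp is [- w']. *)
have [w' Ww' vw'] := projection (w - p) cW.
have a2 := nrm_proj Vp wp; rewrite w1 expr1n in a2.
have b2 := nrm_proj Ww' vw'.
have := MP (w - p - w') (- w') vw' (subspaceN cW Ww').
rewrite opprK subrK nrmN => /(_ wp) wM.
have : 1 - nrm p ^+ 2 <= nrm w'.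
  have := normr_dot_le w' w; rewrite w1 mulr1; apply: le_trans.
  apply: le_trans (ler_norm _).
  have -> : << w', w >> = nrm (w - p) ^+ 2; last by lra.
  have := vw' w Ww; rewrite dotBl => /subr0_eq <-.
  by rewrite nrm2 [in RHS]dotBr (wp p Vp) subr0.
have := nrm_ge0 w'; have := nrm_ge0 (w - p - w').
set a := nrm p in a2 p0 *; set b := nrm w' in b2 wM *.
set d := nrm (w - p - w') in b2 wM *.
move=> d0 b0 ab.
have [a1|a1] := lerP 1 (a ^+ 2).
  by rewrite (le_trans a1)// ler_peMr ?sqr_ge0//; have := sqr_ge0 M; lra.
have bM : b ^+ 2 <= M ^+ 2 * d ^+ 2.
  by rewrite -exprMn ler_pXn2r ?nnegrE ?mulr_ge0.
have ab2 : (1 - a ^+ 2) ^+ 2 <= b ^+ 2 by rewrite ler_pXn2r ?nnegrE// subr_ge0 ltW.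
(* The chain is [(1 - a ^+ 2) ^+ 2 <= b ^+ 2 <= M ^+ 2 * d ^+ 2], with [d ^+ 2 = 1 - a ^+ 2 - b ^+ 2
   <= (1 - a ^+ 2) * a ^+ 2]; cancel [1 - a ^+ 2]. *)
suff : (1 - a ^+ 2) <= M ^+ 2 * a ^+ 2 by lra.
have a1' : 0 < 1 - a ^+ 2 by lra.
rewrite -(ler_pM2r a1') -expr2 -[leRHS]mulrA.
apply: (le_trans ab2); apply: (le_trans bM); apply: ler_wpM2l; first exact: sqr_ge0.
have -> : d ^+ 2 = 1 - a ^+ 2 - b ^+ 2 by lra.
by lra.
Qed.
End oblique.

End SemiHilbertTheory.

(** * Completeness of real L^2 *)

Section RieszFischer.
Context d (T : measurableType d) (R : realType).
Context (mu : {measure set T -> \bar R}).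
Implicit Types (f g : T -> R).

Lemma Lnorm2E f :
  'N[mu]_2%:E[EFin \o f]%E = ((\int[mu]_x (f x ^+ 2)%:E) `^ 2^-1)%E.
Proof.
rewrite unlock; congr (_ `^ _)%E; apply: eq_integral => x _ /=.
by rewrite powR_mulrn// real_normK ?num_real.
Qed.

Lemma Lfun2P f : f \in Lfun mu 2%:E <->
  measurable_fun setT f /\ (\int[mu]_x (f x ^+ 2)%:E < +oo)%E.
Proof.
split=> [/andP[/[!inE] mf]|[mf fy]].
  rewrite /= /finite_norm Lnorm2E => /lty_poweRy fy.
  by split => //; apply: fy; rewrite invr_eq0 pnatr_eq0.
by apply/andP; rewrite !inE; split=> //=; rewrite /finite_norm Lnorm2E poweR_lty.
Qed.

Lemma measurable_sqr_EFin f : measurable_fun setT f ->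
  measurable_fun setT (fun x => (f x ^+ 2)%:E).
Proof.
by move=> mf; apply/measurable_EFinP; exact: measurable_funX.
Qed.

Lemma measurable_fun_limn_einf (h : (T -> \bar R)^nat) :
  (forall n, measurable_fun setT (h n)) ->
  measurable_fun setT (fun x => limn_einf (h ^~ x)).
Proof.
move=> mh; apply: (measurableT_comp (@oppe_measurable R setT)).
by apply: measurable_fun_limn_esup => n; exact: measurableT_comp.
Qed.

Lemma limn_einf_le (u : nat -> \bar R) b : (forall n, u n <= b)%E ->
  (limn_einf u <= b)%E.
Proof.
move=> ub; rewrite limn_einf_lim; apply: lime_le; first exact: is_cvg_einfs.
apply: nearW => n; apply: (le_trans _ (ub n)).
by apply: ereal_inf_lbound; exists n => /=.
Qed.

(* [\sum 4 ^ n (u (n + 1) - u n) ^ 2] is integrable, hence finite almost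
   everywhere, and then the increments of [u] are dominated by [2 ^ - n]. *)
Lemma cvg_ae_of_cauchy (u : nat -> T -> R) :
  (forall n, measurable_fun setT (u n)) ->
  (forall n, \int[mu]_x ((u n.+1 x - u n x) ^+ 2)%:E <= (8^-1 ^+ n)%:E)%E ->
  {ae mu, forall x, cvgn (u ^~ x)}.
Proof.
move=> mu_ ud.
pose s n x := (4 ^+ n * (u n.+1 x - u n x) ^+ 2)%:E.
have ms n : measurable_fun setT (s n).
  apply/measurable_EFinP; apply: measurable_funM => //.
  by apply: measurable_funX; exact: measurable_funB.
have s0 n x : (0 <= s n x)%E by rewrite lee_fin mulr_ge0 ?sqr_ge0 ?exprn_ge0.
pose g x := (\sum_(n <oo) s n x)%E.
have g0 x : (0 <= g x)%E by apply: nneseries_ge0 => n *; exact: s0.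
have mg : measurable_fun setT g.
  by apply: (@ge0_emeasurable_sum _ _ _ setT s predT) => // n x _ _; exact: s0.
have ig : (\int[mu]_x g x < +oo)%E.
  rewrite integral_nneseries//.
  (* The n-th integral is at most [4 ^+ n * 8^-1 ^+ n = 2^-1 ^+ n]. *)
  apply: (@le_lt_trans _ _ (\sum_(n <oo) (geometric 1 2^-1 n)%:E)%E).
    apply: lee_nneseries => [n _ _|n _]; first by apply: integral_ge0 => x _; exact: s0.
    rewrite /s; under eq_integral do rewrite EFinM.
    rewrite ge0_integralZl_EFin//; [|by move=> x _; rewrite lee_fin sqr_ge0|
      by apply: measurable_sqr_EFin; exact: measurable_funB].
    apply: (le_trans (lee_wpmul2l _ (ud n))); first by rewrite lee_fin exprn_ge0.
    rewrite -EFinM lee_fin /= mul1r -exprMn le_eqVlt; apply/orP; left; apply/eqP.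
    by congr (_ ^+ _); lra.
  have h := @cvg_geometric_series R 1 2^-1 _.
  rewrite [ltLHS](_ : _ = (1 * (1 - 2^-1)^-1 : R)%:E) ?ltry//.
  apply: cvg_lim => //; apply: cvg_EFin.
    by apply: nearW => n; rewrite sumEFin.
  rewrite (_ : _ \o _ = series (geometric (1 : R) 2^-1)).
    by apply: h; rewrite ger0_norm; lra.
  by apply/funext => n /=; rewrite sumEFin.
have /integrable_ae : mu.-integrable setT g.
  apply/integrableP; split => //; under eq_integral do rewrite gee0_abs//.
  exact: ig.
move=> /(_ measurableT); apply: filterS => x /(_ I) gx.
pose D := fun n => u n.+1 x - u n x.
have -> : u ^~ x = (fun n => u 0%N x + series D n).
  by apply/funext => n; rewrite (eq_sum_telescope (u ^~ x)).
apply: is_cvgD; first exact: is_cvg_cst.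
apply: normed_cvg.
pose C := Num.sqrt (fine (g x)).
apply: (@series_le_cvg _ _ (geometric C 2^-1)).
- by move=> n; exact: normr_ge0.
- by move=> n; rewrite geometric_ge0 ?sqrtr_ge0.
- move=> n; rewrite /= -(@ler_pXn2r _ 2) ?nnegrE ?normr_ge0 ?mulr_ge0 ?sqrtr_ge0//.
  rewrite real_normK ?num_real// exprMn sqr_sqrtr ?fine_ge0//.
  have : (s n x <= g x)%E.
    apply: (le_trans _ (nneseries_lim_ge n.+1 _)) => //.
    rewrite big_nat_recr//= leeDr//; apply: sume_ge0 => i _; exact: s0.
  rewrite -(fineK gx) lee_fin mulrC -ler_pdivlMr ?exprn_gt0//.
  suff -> : (2^-1 ^+ n) ^+ 2 = (4 ^+ n)^-1 :> R by [].
  by rewrite exprAC -exprVn; congr (_ ^+ _); lra.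
- by apply: is_cvg_geometric_series; rewrite ger0_norm; lra.
Qed.

(** Riesz-Fischer: Fatou's lemma carries the Cauchy bound over to the almost everywhere limit. *)
Lemma L2_complete (u : nat -> T -> R) :
  (forall n, u n \in Lfun mu 2%:E) ->
  (forall n m, (n <= m)%N ->
    \int[mu]_x ((u m x - u n x) ^+ 2)%:E <= (8^-1 ^+ n)%:E)%E ->
  exists2 l, l \in Lfun mu 2%:E &
    forall n, (\int[mu]_x ((l x - u n x) ^+ 2)%:E <= (8^-1 ^+ n)%:E)%E.
Proof.
move=> u2 ucau.
have mu_ n : measurable_fun setT (u n) by have /Lfun2P[] := u2 n.
have ucvg := cvg_ae_of_cauchy mu_ (fun n => ucau n n.+1 (leqnSn n)).
(* The upper limit is measurable and defined everywhere, and it is the limit wherever the sequence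
   converges. *)
pose l x := fine (limn_esup (fun n => (u n x)%:E)).
have ml : measurable_fun setT l.
  apply: (measurableT_comp (fine_measurable measurableT)).
  by apply: measurable_fun_limn_esup => n; exact/measurable_EFinP.
have lcvg x : cvgn (u ^~ x) -> u n x @[n --> \oo] --> l x.
  move=> /[dup] ux /cvg_ex[a ua]; suff -> : l x = a by [].
  have uax : (u n x)%:E @[n --> \oo] --> a%:E by apply: cvg_EFin => //; exact: nearW.
  by rewrite /l is_cvg_limn_esupE; [rewrite (cvg_lim _ uax)|apply/cvg_ex; exists a%:E].
have lu n : (\int[mu]_x ((l x - u n x) ^+ 2)%:E <= (8^-1 ^+ n)%:E)%E.
  pose h k x := ((u (k + n)%N x - u n x) ^+ 2)%:E.
  have mh k : measurable_fun setT (h k).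
    by apply: measurable_sqr_EFin; exact: measurable_funB.
  have h0 k x : (0 <= h k x)%E by rewrite lee_fin sqr_ge0.
  have -> : (\int[mu]_x ((l x - u n x) ^+ 2)%:E = \int[mu]_x limn_einf (h ^~ x))%E.
    apply: ae_eq_integral => //.
    - by apply: measurable_sqr_EFin; exact: measurable_funB.
    - exact: measurable_fun_limn_einf.
    apply: filterS ucvg => x /lcvg ux _.
    apply/esym/(cvg_limn_einf_sup _).1; apply: cvg_EFin; first exact: nearW.
    apply: cvgM; (apply: cvgB; last exact: cvg_cst);
      by rewrite (@cvg_shiftn n _ (u ^~ x)).
  apply: le_trans (fatou _ _ _ _) _ => //.
  by apply: limn_einf_le => k; exact/ucau/leq_addl.
exists l => //; apply/Lfun2P; split => //.
pose d0 x := l x - u 0%N x.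
have d2 : d0 \in Lfun mu 2%:E.
  apply/Lfun2P; split; first exact: measurable_funB.
  by apply: (le_lt_trans (lu 0%N)); exact: ltry.
have /Lfun2P[_] := (Lfun_submod_closed mu (lee1n 2)).2 1 _ _ d2 (u2 0%N).
suff -> : 1 *: d0 + u 0%N = l by [].
by apply/funext => x; rewrite scale1r /d0 /= subrK.
Qed.

End RieszFischer.

(** * The real inner product of L^2 *)

Section L2dot.
Context d (T : measurableType d) (R : realType).
Context (mu : {measure set T -> \bar R}).
Local Notation L := (LfunType mu (lee1n 2)).
Implicit Types (f g h : L).

Definition L2dot f g : R := (\int[mu]_x (f x * g x))%R.

Lemma integrable_mul f g : mu.-integrable setT (EFin \o (fun x => f x * g x)).
Proof. by apply/Lfun1_integrable; apply: Lfun2_mul_Lfun1; exact: LfunP. Qed.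

Lemma L2dotC f g : L2dot f g = L2dot g f.
Proof. by apply: eq_Rintegral => x _; rewrite mulrC. Qed.

Lemma L2dotPl a f g h : L2dot (a *: f + g) h = a * L2dot f h + L2dot g h.
Proof.
have afh : mu.-integrable setT (EFin \o (fun x => a * (f x * h x))).
  have := integrable_mul (a *: f) h.
  by apply: eq_integrable => // x _ /=; rewrite mulrA.
rewrite /L2dot -RintegralZl//; last exact: integrable_mul.
rewrite -RintegralD//; last exact: integrable_mul.
by apply: eq_Rintegral => x _ /=; rewrite mulrDl mulrA.
Qed.

Lemma L2dotE f : (L2dot f f)%:E = (\int[mu]_x (f x ^+ 2)%:E)%E.
Proof.
by rewrite /L2dot /Rintegral fineK//; exact/integrable_fin_num/integrable_mul.
Qed.

Lemma L2dot_ge0 f : 0 <= L2dot f f.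
Proof.
by rewrite -lee_fin L2dotE; apply: integral_ge0 => x _; rewrite lee_fin sqr_ge0.
Qed.

Lemma L2dot_cvg (u : nat -> L) :
  (forall n m, (n <= m)%N -> L2dot (u m - u n) (u m - u n) <= 8^-1 ^+ n) ->
  exists l, L2dot (l - u n) (l - u n) @[n --> \oo] --> 0.
Proof.
move=> ucau; have [||l l2 lu] := @L2_complete _ _ _ mu (fun n => u n).
- by move=> n; exact: LfunP.
- by move=> n m nm; rewrite -[leLHS](L2dotE (u m - u n)) lee_fin; exact: ucau.
pose l' : L := Lfun_Sub (lee1n 2) l2.
exists l'; apply: (@squeeze_cvgr _ _ _ _ (fun=> 0) (fun n => 8^-1 ^+ n)).
- apply: nearW => n; rewrite L2dot_ge0 -lee_fin L2dotE; exact: lu.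
- exact: cvg_cst.
- by apply: cvg_expr; rewrite ger0_norm; lra.
Qed.

Definition L2_semiHilbert : semiHilbert L :=
  SemiHilbert L2dotC L2dotPl L2dot_ge0 L2dot_cvg.

End L2dot.

(** * Products, for real and imaginary parts *)

Section prod_semiHilbert.
Context (R : realType) (E1 E2 : lmodType R).
Context (H1 : semiHilbert E1) (H2 : semiHilbert E2).

Definition prod_dot (x y : E1 * E2) := dot H1 x.1 y.1 + dot H2 x.2 y.2.

Lemma prod_dotC x y : prod_dot x y = prod_dot y x.
Proof. by rewrite /prod_dot dotC (dotC H2). Qed.

Lemma prod_dotPl a x y z : prod_dot (a *: x + y) z = a * prod_dot x z + prod_dot y z.
Proof. by rewrite /prod_dot !dotPl; ring. Qed.

Lemma prod_dot_ge0 x : 0 <= prod_dot x x.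
Proof. by rewrite addr_ge0// dot_ge0. Qed.

Lemma prod_dot_cvg (u : nat -> E1 * E2) :
  (forall n m, (n <= m)%N -> prod_dot (u m - u n) (u m - u n) <= 8^-1 ^+ n) ->
  exists l, prod_dot (l - u n) (l - u n) @[n --> \oo] --> 0.
Proof.
move=> ucau.
have [|l1 h1] := @dot_cvg _ _ H1 (fun n => (u n).1).
  move=> n m nm; apply: (le_trans _ (ucau n m nm)).
  by rewrite /prod_dot lerDl dot_ge0.
have [|l2 h2] := @dot_cvg _ _ H2 (fun n => (u n).2).
  move=> n m nm; apply: (le_trans _ (ucau n m nm)).
  by rewrite /prod_dot lerDr dot_ge0.
by exists (l1, l2); rewrite -[0]addr0; exact: cvgD h1 h2.
Qed.

Definition prod_semiHilbert : semiHilbert (E1 * E2)%type :=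
  SemiHilbert prod_dotC prod_dotPl prod_dot_ge0 prod_dot_cvg.

End prod_semiHilbert.

(** * Complex L^2(R^k) as a real space *)

Section L2_Rk.
Context (R : realType) (k : nat).
Local Notation mu := (lebesgue_Rk R k).
Local Notation fct := (Rk R k -> R[i]).
Local Notation L := (LfunType mu (lee1n 2)).
Local Open Scope complex_scope.
Implicit Types (p q : L * L) (f g : fct) (S : set fct).

Let H : semiHilbert (L * L)%type :=
  prod_semiHilbert (L2_semiHilbert mu) (L2_semiHilbert mu).

Definition cfun p : fct := fun x => p.1 x +i* p.2 x.

Lemma cfunP a p q x : cfun (a *: p + q) x = a%:C * cfun p x + cfun q x.
Proof. by rewrite /cfun /=; simpc. Qed.

Lemma cfunB p q : cfun (p - q) = cfun p - cfun q.
Proof. by apply/funext => x; rewrite /cfun /=; simpc. Qed.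

Lemma L2_cfun p : L2 (cfun p).
Proof. by split; exact: LfunP. Qed.

Lemma cfun_surj f : L2 f -> exists p, f = cfun p.
Proof.
move=> [f1 f2]; exists (Lfun_Sub (lee1n 2) f1, Lfun_Sub (lee1n 2) f2).
by apply/funext => x; rewrite /cfun /=; case: (f x).
Qed.

Lemma normc_sqr (z : R[i]) :
  ComplexField.Normc.normc z ^+ 2 = complex.Re z ^+ 2 + complex.Im z ^+ 2.
Proof. by case: z => a b /=; rewrite sqr_sqrtr// addr_ge0 ?sqr_ge0. Qed.

Lemma l2normE f :
  l2norm f =
  ((\int[mu]_x (complex.Re (f x) ^+ 2 + complex.Im (f x) ^+ 2)%:E) `^ 2^-1)%E.
Proof.
rewrite /l2norm (Lnorm2E mu (fun x => ComplexField.Normc.normc (f x))).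
by congr (_ `^ _)%E; apply: eq_integral => x _; rewrite normc_sqr.
Qed.

Lemma l2norm_cfun p : l2norm (cfun p) = (nrm H p)%:E.
Proof.
rewrite l2normE /=; under eq_integral do rewrite EFinD.
rewrite ge0_integralD//; last 4 first.
- by move=> x _; rewrite lee_fin sqr_ge0.
- by apply: measurable_sqr_EFin.
- by move=> x _; rewrite lee_fin sqr_ge0.
- by apply: measurable_sqr_EFin.
by rewrite -!L2dotE -EFinD poweR_EFin powR12_sqrt// (dot_ge0 H).
Qed.

Lemma RintegralD_mul (a b c e : L) :
  (\int[mu]_x (a x * b x + c x * e x))%R = L2dot a b + L2dot c e.
Proof. by rewrite RintegralD//; exact: integrable_mul. Qed.

(** The pair [(- q.2, q.1)] represents [i] times [cfun q]. *)
Lemma l2dot_cfun p q :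
  l2dot (cfun p) (cfun q) = dot H p q +i* dot H p (- q.2, q.1).
Proof.
rewrite /l2dot; congr (_ +i* _).
  rewrite /= /prod_dot /= -RintegralD_mul; apply: eq_Rintegral => x _ /=.
  by rewrite mulrN opprK.
rewrite /= /prod_dot /= -RintegralD_mul; apply: eq_Rintegral => x _ /=.
by [].
Qed.

Lemma measurable_sqr_norm f :
  measurable_fun setT (fun x => complex.Re (f x)) ->
  measurable_fun setT (fun x => complex.Im (f x)) ->
  measurable_fun setT (fun x => (complex.Re (f x) ^+ 2 + complex.Im (f x) ^+ 2)%:E).
Proof.
move=> mRe mIm; apply/measurable_EFinP.
by apply: measurable_funD; exact: measurable_funX.
Qed.

(** A nonnegative measurable function of zero integral vanishes almost everywhere. *)
Lemma ae_eq0_cfun p : cfun p = 0 %[ae mu] <-> nrm H p = 0.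
Proof.
set h := fun x => ((p.1 x ^+ 2 + p.2 x ^+ 2)%:E : \bar R).
have mh : measurable_fun setT h by exact: (@measurable_sqr_norm (cfun p)).
have h0 x : (0 <= h x)%E by rewrite lee_fin addr_ge0 ?sqr_ge0.
have -> : (cfun p = 0 %[ae mu]) <-> ae_eq mu setT h (cst 0%E).
  split; apply: filterS => x /(_ I) hx _.
    by move: hx; rewrite /h => -[-> ->]; rewrite expr0n /= addr0.
  move: hx => [] /eqP; rewrite paddr_eq0 ?sqr_ge0// !sqrf_eq0 => /andP[/eqP p1 /eqP p2].
  by rewrite /cfun p1 p2.
rewrite -(ae_eq_integral_abs mu measurableT mh).
under eq_integral do rewrite gee0_abs//.
have : ((\int[mu]_x h x) `^ 2^-1)%E = (nrm H p)%:E by rewrite -l2norm_cfun l2normE.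
have i0 : (0 <= \int[mu]_x h x)%E by exact: integral_ge0.
move=> e; split=> [ih0|n0].
  by apply/EFin_inj; rewrite -e ih0 poweR0r// invr_neq0.
by move: e; rewrite n0 => /poweR_eq0_eq0; exact.
Qed.

(** * From shift-invariant spaces to closed real subspaces stable under [i] *)

Lemma L2_of_l2norm f :
  measurable_fun setT (fun x => complex.Re (f x)) ->
  measurable_fun setT (fun x => complex.Im (f x)) ->
  (l2norm f < +oo)%E -> L2 f.
Proof.
move=> mRe mIm; rewrite l2normE => /lty_poweRy fy.
have {}fy := fy (invr_neq0 (lt0r_neq0 (ltr0n R 2))).
split; apply/Lfun2P; split => //; apply: le_lt_trans fy.
  apply: ge0_le_integral => //.
  - by move=> x _; rewrite lee_fin sqr_ge0.
  - exact: measurable_sqr_EFin.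
  - exact: measurable_sqr_norm.
  - by move=> x _; rewrite lee_fin lerDl sqr_ge0.
apply: ge0_le_integral => //.
- by move=> x _; rewrite lee_fin sqr_ge0.
- exact: measurable_sqr_EFin.
- exact: measurable_sqr_norm.
- by move=> x _; rewrite lee_fin lerDr sqr_ge0.
Qed.

(** This is the property passed on to translates and their spans; [cfun_approx] recovers square
    integrability from finite distances. *)
Definition cmeasurable f := measurable_fun setT (fun x => complex.Re (f x)) /\
  measurable_fun setT (fun x => complex.Im (f x)).

Lemma cmeasurable_cfun p : cmeasurable (cfun p).
Proof. by split. Qed.

Lemma cmeasurableD f g : cmeasurable f -> cmeasurable g -> cmeasurable (f + g).
Proof.
move=> [fR fI] [gR gI]; split.
  apply: (eq_measurable_fun (fun x => complex.Re (f x) + complex.Re (g x))).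
    by move=> x _ /=; rewrite /GRing.add /=; case: (f x); case: (g x).
  exact: measurable_funD.
apply: (eq_measurable_fun (fun x => complex.Im (f x) + complex.Im (g x))).
  by move=> x _ /=; rewrite /GRing.add /=; case: (f x); case: (g x).
exact: measurable_funD.
Qed.

Lemma cmeasurableZ (c : R[i]) f : cmeasurable f -> cmeasurable (fun x => c * f x).
Proof.
case: c => a b [fR fI]; split.
  apply: (eq_measurable_fun (fun x => a * complex.Re (f x) - b * complex.Im (f x))).
    by move=> x _ /=; case: (f x).
  by apply: measurable_funB; exact: measurable_funM.
apply: (eq_measurable_fun (fun x => a * complex.Im (f x) + b * complex.Re (f x))).
  by move=> x _ /=; case: (f x).
by apply: measurable_funD; exact: measurable_funM.
Qed.

Lemma cmeasurable_translate m f : cmeasurable f -> cmeasurable (translate m f).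
Proof.
have mt : measurable_fun setT
    (fun x : Rk R k => [tuple (tnth x i : R) - (tnth m i)%:~R | i < k] : Rk R k).
  apply/measurable_fun_tnthP => i; rewrite /comp /=.
  under eq_fun do rewrite tnth_mktuple.
  by apply: measurable_funB; [exact: measurable_tnth|exact: measurable_cst].
by move=> [fR fI]; split; [exact: (measurableT_comp fR mt)|
  exact: (measurableT_comp fI mt)].
Qed.

Lemma cmeasurable_span S f : (forall g, S g -> cmeasurable g) ->
  linear_span S f -> cmeasurable f.
Proof.
move=> mS [n [c [g [gS ->]]]].
elim: n c g gS => [|n IH] c g gS.
  by under [X in cmeasurable X]eq_fun do rewrite big_ord0; split; exact: measurable_cst.
under [X in cmeasurable X]eq_fun do rewrite big_ord_recr.
apply: cmeasurableD; last exact/cmeasurableZ/mS/gS.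
by apply: (IH (fun i => c (widen_ord (leqnSn n) i))
              (fun i => g (widen_ord (leqnSn n) i))).
Qed.

Lemma linear_spanP S (a : R[i]) f g : linear_span S f -> linear_span S g ->
  linear_span S (fun x => a * f x + g x).
Proof.
move=> [n [c [u [uS ->]]]] [m [e [v [vS ->]]]].
exists (n + m)%N, (fun i : 'I_(n + m) =>
  match fintype.split i with inl j => a * c j | inr j => e j end).
exists (fun i : 'I_(n + m) =>
  match fintype.split i with inl j => u j | inr j => v j end).
split; first by move=> i; case: (fintype.split i).
apply/funext => x; rewrite big_split_ord /= mulr_sumr; congr (_ + _).
  apply: eq_bigr => i _; rewrite mulrA.
  case: fintype.splitP => [j /= ij|j /= ij]; first by rewrite (ord_inj ij : i = j).
  by have := ltn_ord i; rewrite ij ltnNge leq_addr.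
apply: eq_bigr => i _.
case: fintype.splitP => [j /= ij|j /= /addnI ij]; last by rewrite (ord_inj ij : i = j).
by have := ltn_ord j; rewrite -ij ltnNge leq_addr.
Qed.

Definition ipair p : L * L := (- p.2, p.1).

Lemma cfun_ipair p : cfun (ipair p) = (fun x => (0 +i* 1) * cfun p x).
Proof. by apply/funext => x; rewrite /cfun /=; simpc. Qed.

Lemma dot_ipair p q : dot H (ipair p) q = - dot H p (ipair q).
Proof.
rewrite /= /prod_dot /=.
have N1 (a b : L) : L2dot (- a) b = - L2dot a b := dotNl (L2_semiHilbert mu) a b.
have N2 (a b : L) : L2dot a (- b) = - L2dot a b := dotNr (L2_semiHilbert mu) b a.
by rewrite N1 N2 addrC opprD opprK.
Qed.

Definition closed_Csubspace S := [/\ S `<=` L2 (R:=R) (k:=k),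
  closed_subspace H (cfun @^-1` S) &
  forall f, S f -> S (fun x => (0 +i* 1) * f x)].

(** The imaginary part of the complex product with [q] is the real product with [i q], again a
    member of [S]. *)
Lemma orthocomplP S p : closed_Csubspace S ->
  orthocompl S (cfun p) <-> orth H (cfun @^-1` S) p.
Proof.
move=> [SL2 _ Si]; split=> [[_ pS] q Sq|pS].
  by have := pS _ Sq; rewrite l2dot_cfun => -[].
split; first exact: L2_cfun.
move=> g Sg; have [q gq] := cfun_surj (SL2 _ Sg); rewrite gq l2dot_cfun.
rewrite pS ?pS //=; last by rewrite -gq.
by rewrite [X in S X](cfun_ipair q) -gq; exact: Si.
Qed.

Lemma preimage_orthocompl S : closed_Csubspace S ->
  cfun @^-1` (orthocompl S) = orth H (cfun @^-1` S).
Proof. by move=> cS; apply/seteqP; split=> p /= /(orthocomplP p cS). Qed.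

Lemma orthocompl_Csubspace S : closed_Csubspace S -> closed_Csubspace (orthocompl S).
Proof.
move=> cS; split=> [f []//| |f fS].
  by rewrite preimage_orthocompl//; exact: orth_closed_subspace.
have [p fp] := cfun_surj fS.1; rewrite fp -cfun_ipair.
apply/orthocomplP => // q Sq; rewrite dot_ipair.
move: fS; rewrite fp => /(orthocomplP p cS) ->; first by rewrite oppr0.
by case: cS => _ _ Si; rewrite /preimage /= cfun_ipair; exact: Si.
Qed.

(** The difference between [cfun p] and an approximant is measurable of finite norm, hence given by
    a pair [r] of the real space, where the Hilbert estimates apply. *)
Lemma cfun_approx S p (e : R) : (forall g, S g -> cmeasurable g) ->
  (exists2 g, linear_span S g & (l2norm (cfun p - g)%R < e%:E)%E) <->
  (exists2 r, linear_span S (cfun p - cfun r) & nrm H r < e).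
Proof.
move=> mS; split=> [[g Sg pg]|[r Sr re]]; last first.
  by exists (cfun p - cfun r) => //; rewrite subKr l2norm_cfun lte_fin.
have [mR mI] : cmeasurable (cfun p - g).
  rewrite (_ : cfun p - g = cfun p + (fun x => (-1) * g x)).
    by apply: cmeasurableD => //; apply: cmeasurableZ; exact: cmeasurable_span Sg.
  by congr (_ + _); apply/funext => x; rewrite mulN1r.
have [r rE] := cfun_surj (L2_of_l2norm mR mI (lt_trans pg (ltry _))).
exists r; first by rewrite -rE subKr.
by move: pg; rewrite rE l2norm_cfun lte_fin.
Qed.

Lemma FSI_Csubspace S : FSI S -> closed_Csubspace S.
Proof.
move=> [A [_ A2 ->]]; set G := [set h | _].
have mG g : G g -> cmeasurable g.
  move=> [f [m [Af ->]]]; apply: cmeasurable_translate.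
  by have [p ->] := cfun_surj (A2 _ Af); exact: cmeasurable_cfun.
have clP p : l2closure (linear_span G) (cfun p) <->
    forall e : R, 0 < e -> exists2 r, linear_span G (cfun p - cfun r) & nrm H r < e.
  split=> [[_ pG] e e0|pG]; first exact/cfun_approx/pG.
  by split=> [|e e0]; [exact: L2_cfun|exact/cfun_approx/pG].
split=> [f []//| |f fG].
  split=> [|a p q /clP pG /clP qG|p pG]; apply/clP => e e0.
  - exists 0; last by rewrite nrm0.
    rewrite subrr; exists 0%N, (fun=> 0), (fun=> 0); split=> [[]//|].
    by apply/funext => x; rewrite big_ord0.
  - have a1 : 0 < `|a| + 1 by have := normr_ge0 a; lra.
    have [r rG re] := pG _ (divr_gt0 e0 (mulr_gt0 (ltr0n R 2) a1)).
    have [s sG se] := qG _ (divr_gt0 e0 (ltr0n R 2)).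
    exists (a *: r + s).
      have := linear_spanP a%:C rG sG; congr linear_span.
      apply/funext => x /=.
      change (a%:C * (cfun p x - cfun r x) + (cfun q x - cfun s x) =
        cfun (a *: p + q) x - cfun (a *: r + s) x).
      by rewrite !cfunP; ring.
    have := nrmD H (a *: r) s; rewrite nrmZ.
    move: re; rewrite ltr_pdivlMr ?mulr_gt0//.
    by have := normr_ge0 a; have := nrm_ge0 H r; nra.
  - have [q /clP qG pq] := pG _ (divr_gt0 e0 (ltr0n R 2)).
    have [r rG re] := qG _ (divr_gt0 e0 (ltr0n R 2)).
    (* Taking this error away from [p] leaves [q - r], the approximant of [q]. *)
    exists (p - q + r).
      by move: rG; rewrite -!cfunB opprD opprB addrA (addrC p) subrK.
    by have := nrmD H (p - q) r; lra.
have [p fp] := cfun_surj fG.1; move: fG; rewrite fp => /clP pG.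
rewrite -cfun_ipair; apply/clP => e e0; have [r rG re] := pG e e0.
exists (ipair r).
  have zG : linear_span G (fun=> 0).
    exists 0%N, (fun=> 0), (fun=> 0); split=> [[]//|].
    by apply/funext => x; rewrite big_ord0.
  have := linear_spanP (0 +i* 1) rG zG; congr linear_span.
  apply/funext => x; rewrite addr0 !cfun_ipair.
  by rewrite -[RHS]mulrBr.
by rewrite /nrm dot_ipair (_ : ipair (ipair r) = - r)// dotNr opprK.
Qed.

(** The existence of a decomposition rules out the default value of [xget]. *)
Lemma oblique_projP S N p : S `<=` L2 (R:=R) (k:=k) ->
  (exists2 q, S (cfun q) & N (cfun (p - q))) ->
  exists q, [/\ oblique_proj S N (cfun p) = cfun q, S (cfun q) & N (cfun (p - q))].
Proof.
move=> SL2 [q0 Sq0 Nq0].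
have [|Sg Ng] := @xgetPex _ (0 : fct) [set g | S g /\ N (cfun p - g)].
  by exists (cfun q0); rewrite /= -cfunB.
have [q gq] := cfun_surj (SL2 _ Sg).
exists q; rewrite cfunB -gq; split => //.
Qed.

Lemma orth_projP S p : closed_Csubspace S -> exists q,
  [/\ orth_proj S (cfun p) = cfun q, S (cfun q) & orth H (cfun @^-1` S) (p - q)].
Proof.
move=> cS; have [SL2 clS _] := cS.
have [|q [pq Sq Nq]] := @oblique_projP S (orthocompl S) p SL2.
  have [q Sq pq] := projection p clS; exists q => //.
  exact/orthocomplP.
by exists q; split => //; exact/orthocomplP.
Qed.

Lemma tan_acos (c : R) : 0 < c -> c <= 1 -> tan (acos c) = Num.sqrt (1 - c ^+ 2) / c.
Proof.
move=> c0 c1; have c11 : -1 <= c <= 1 by rewrite c1 andbT; lra.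
by rewrite /tan acosK// sin_acos.
Qed.

(** * The aliasing norm *)

Section aliasing.
Context (V W : set fct).
Context (cV : closed_Csubspace V) (cW : closed_Csubspace W).
Context (hVW : direct_sum_L2 V (orthocompl W)).
Local Notation V' := (cfun @^-1` V).
Local Notation W' := (cfun @^-1` W).

Let VL2 : V `<=` L2 (R:=R) (k:=k). Proof. by case: cV. Qed.
Let WL2 : W `<=` L2 (R:=R) (k:=k). Proof. by case: cW. Qed.
Let clV : closed_subspace H V'. Proof. by case: cV. Qed.
Let clW : closed_subspace H W'. Proof. by case: cW. Qed.

(** The given decomposition holds almost everywhere: [p - v] differs from [w] by a null vector,
    which the closed W^perp absorbs. *)
Lemma VW_dec p : exists2 v, V' v & orth H W' (p - v).
Proof.
have [f [g [Vf Wg pfg]]] := hVW.1 _ (L2_cfun p).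
have [v fv] := cfun_surj (VL2 Vf); have [w gw] := cfun_surj Wg.1.
exists v; first by rewrite /preimage /= -fv.
have Ww : orth H W' w by apply/(orthocomplP w cW); rewrite -gw.
apply: (subspace_null (orth_closed_subspace _ _) Ww); apply/ae_eq0_cfun.
apply: filterS pfg => x /= + _ => /(_ I); rewrite fv gw => pvw.
rewrite !cfunB /=.
change (cfun p x - cfun v x - cfun w x = 0); rewrite pvw.
by rewrite -addrA -opprD subrr.
Qed.

Lemma VW_cap p : V' p -> orth H W' p -> nrm H p = 0.
Proof.
move=> Vp Wp; apply/ae_eq0_cfun/(hVW.2 _ Vp).
exact/orthocomplP.
Qed.

Local Notation proj_norms :=
  [set l2norm (orth_proj V f) | f in [set f | W f /\ l2norm f = 1%E]].

(** [c] is the cosine of the aperture, positive by [coercive]; [w] provides a unit vector, so the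
    infimum is at most 1. The last two clauses feed [oblique_le] and [oblique_sup]. *)
Lemma proj_norms_bound (w : L * L) : W' w -> 0 < nrm H w ->
  exists c : R, [/\ 0 < c, c <= 1, ereal_inf proj_norms = c%:E,
    (forall w p, W' w -> V' p -> orth H V' (w - p) -> c * nrm H w <= nrm H p) &
    (forall e, 0 < e -> exists w p, [/\ W' w, V' p, orth H V' (w - p),
      nrm H w = 1 & nrm H p < c + e])].
Proof.
move=> Ww w0.
have [c0 c0_gt0 c0P] := coercive clV clW VW_dec.
have normP f : W f -> l2norm f = 1%E -> exists w p, [/\ W' w, V' p,
    orth H V' (w - p), nrm H w = 1 & l2norm (orth_proj V f) = (nrm H p)%:E].
  move=> Wf f1; have [u fu] := cfun_surj (WL2 Wf).
  have [p [pE Vp up]] := orth_projP u cV.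
  exists u, p; split => //; first by rewrite /preimage /= -fu.
    by move: f1; rewrite fu l2norm_cfun => -[].
  by rewrite fu pE l2norm_cfun.
have inf_ge : (c0%:E <= ereal_inf proj_norms)%E.
  apply: le_ereal_inf_tmp => _ [f [Wf f1] <-].
  have [u [p [Wu Vp up u1 ->]]] := normP _ Wf f1.
  by rewrite lee_fin; have := c0P _ _ Wu Vp up; rewrite u1 mulr1.
have [u [Wu u1]] : exists u, W' u /\ nrm H u = 1.
  exists ((nrm H w)^-1 *: w); split; first exact: (subspaceZ clW).
  by rewrite nrmZ ger0_norm ?invr_ge0 ?nrm_ge0// mulVf// gt_eqF.
have mem_norms x p : W' x -> V' p -> orth H V' (x - p) -> nrm H x = 1 ->
    proj_norms (nrm H p)%:E.
  move=> Wx Vp xp x1; exists (cfun x); first by split => //; rewrite l2norm_cfun x1.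
  have [q [-> Vq xq]] := orth_projP x cV.
  by rewrite l2norm_cfun (nrm_proj_unique clV Vq Vp xq xp).
have inf_le : (ereal_inf proj_norms <= 1%:E)%E.
  have [p Vp up] := projection u clV.
  apply: (le_trans (ereal_inf_lbound (mem_norms _ _ Wu Vp up u1))).
  rewrite lee_fin -(@ler_pXn2r _ 2) ?nnegrE ?nrm_ge0//.
  by have := nrm_proj Vp up; have := sqr_ge0 (nrm H (u - p)); rewrite u1; lra.
have inf_fin : ereal_inf proj_norms \is a fin_num.
  rewrite fin_numE -ltNye -ltey (lt_le_trans _ inf_ge) ?ltNyr//.
  by rewrite (le_lt_trans inf_le)// ltry.
set I := ereal_inf _ in inf_ge inf_le inf_fin *.
exists (fine I); rewrite -!lee_fin -lte_fin fineK//; split => //.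
- by apply: lt_le_trans inf_ge; rewrite lte_fin.
- move=> x p Wx Vp xp.
  have [x0|x0] := eqVneq (nrm H x) 0; first by rewrite x0 mulr0 nrm_ge0.
  have {}x0 : 0 < nrm H x by rewrite lt_def x0 nrm_ge0.
  rewrite -ler_pdivlMr// -lee_fin fineK//.
  have -> : nrm H p / nrm H x = nrm H ((nrm H x)^-1 *: p).
    by rewrite nrmZ ger0_norm ?invr_ge0 ?nrm_ge0// mulrC.
  apply/ereal_inf_lbound/(mem_norms ((nrm H x)^-1 *: x)).
  + exact: (subspaceZ clW).
  + exact: (subspaceZ clV).
  + by rewrite -scalerBr; exact: (subspaceZ (orth_closed_subspace H V')).
  + by rewrite nrmZ ger0_norm ?invr_ge0 ?nrm_ge0// mulVf// gt_eqF.
- move=> e e0; have [_ [f [Wf f1] <-] fe] := lb_ereal_inf_adherent e0 inf_fin.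
  have [x [p [Wx Vp xp x1 pE]]] := normP _ Wf f1.
  exists x, p; split => //.
  by move: fe; rewrite pE -/I -(fineK inf_fin) -EFinD lte_fin.
Qed.

Lemma aliasing_proj p : exists e w, [/\
  (oblique_proj W (orthocompl V) \o orth_proj (orthocompl W)) (cfun p) = cfun w,
  orth H W' e, orth H (orth H W') (p - e), W' w &
  orth H V' (e - w)].
Proof.
have cWo := orthocompl_Csubspace cW.
have [e [eE We pe]] := orth_projP p cWo.
have [|w [wE Ww ew]] := @oblique_projP W (orthocompl V) e WL2.
  have [w Ww ew] := dual_dec clV clW VW_dec VW_cap e.
  by exists w => //; exact/orthocomplP.
exists e, w; split => //; first by rewrite /= eE.
- exact/orthocomplP.
- by move: pe; rewrite preimage_orthocompl.
- exact/orthocomplP.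
Qed.

Lemma aliasing_norm_ge0 : (0 <= aliasing_norm V W)%E.
Proof.
apply: (@le_trans _ _ (l2norm ((oblique_proj W (orthocompl V) \o
  orth_proj (orthocompl W)) (cfun 0)))); first exact: Lnorm_ge0.
apply: ereal_sup_ubound; exists (cfun 0) => //; split; first exact: L2_cfun.
by rewrite l2norm_cfun nrm0 lee_fin.
Qed.

Lemma aliasing_norm_trivial : (forall f, W f -> f = 0 %[ae mu]) ->
  aliasing_norm V W = 0%E.
Proof.
move=> W0; apply/eqP; rewrite eq_le aliasing_norm_ge0 andbT.
apply: ge_ereal_sup => _ [f [fL2 _] <-].
have [p ->] := cfun_surj fL2; have [e [w [-> _ _ Ww _]]] := aliasing_proj p.
by rewrite l2norm_cfun (ae_eq0_cfun w).1//; exact: W0.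
Qed.

(** The upper bound is [oblique_le], as projecting onto W^perp does not increase norms; the lower
    bound is [oblique_sup] with [M] the aliasing norm itself, when finite. *)
Lemma aliasing_norm_nontrivial (w : L * L) : W' w -> 0 < nrm H w ->
  aliasing_norm V W = (tan (acos (fine (ereal_inf proj_norms))))%:E.
Proof.
move=> Ww w0; have [c [c0 c1 -> cP c_adh]] := proj_norms_bound Ww w0.
rewrite tan_acos//; set t := _ / c.
have s0 : 0 <= 1 - c ^+ 2 by rewrite subr_ge0 expr_le1// ltW.
have t0 : 0 <= t by rewrite divr_ge0 ?sqrtr_ge0// ltW.
have tc : t ^+ 2 * c ^+ 2 = 1 - c ^+ 2.
  by rewrite -exprMn divfK ?gt_eqF// sqr_sqrtr.
have c20 : 0 < c ^+ 2 by rewrite exprn_gt0.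
have obl_le e x : orth H W' e -> W' x -> orth H V' (e - x) -> nrm H x <= t * nrm H e.
  move=> We Wx ex; have := oblique_le clV c1 cP (ltW c0) We Wx ex.
  rewrite -tc => h.
  rewrite -(@ler_pXn2r _ 2) ?nnegrE ?(mulr_ge0 t0 (nrm_ge0 H e)) ?nrm_ge0//.
  by rewrite exprMn -(ler_pM2l c20) [leRHS]mulrA [c ^+ 2 * t ^+ 2]mulrC.
apply/eqP; rewrite eq_le; apply/andP; split.
  apply: ge_ereal_sup => _ [f [fL2 f1] <-].
  have [p fp] := cfun_surj fL2; move: f1; rewrite fp l2norm_cfun lee_fin => p1.
  have [e [x [-> We pe Wx ex]]] := aliasing_proj p.
  rewrite l2norm_cfun lee_fin (le_trans (obl_le _ _ We Wx ex))// ler_piMr//.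
  apply: le_trans p1; rewrite -(@ler_pXn2r _ 2) ?nnegrE ?nrm_ge0//.
  by rewrite (nrm_proj We pe) lerDl sqr_ge0.
have A0 := aliasing_norm_ge0.
case AE : (aliasing_norm V W) A0 => [M| |]//; last by move=> _; rewrite leey.
rewrite !lee_fin => M0.
suff : 1 <= (1 + M ^+ 2) * c ^+ 2.
  move=> h; rewrite -(@ler_pXn2r _ 2) ?nnegrE// -(ler_pM2r c20) tc; lra.
apply: (oblique_sup clW (ltW c0) M0 c_adh) => e x We Wx ex.
have [e0|e0] := eqVneq (nrm H e) 0.
  by have := obl_le _ _ We Wx ex; rewrite e0 !mulr0.
have {}e0 : 0 < nrm H e by rewrite lt_def e0 nrm_ge0.
pose r := (nrm H e)^-1; have r0 : 0 <= r by rewrite invr_ge0 nrm_ge0.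
(* The chosen [e2] and [x2] match [r *: e] and [r *: x] only up to null vectors: [r *: e - e2] lies
   in W^perp and in its complement, and [obl_le] then makes [r *: x - x2] null. *)
have [e2 [x2 [TE We2 pe2 Wx2 ex2]]] := aliasing_proj (r *: e).
have Wre : orth H W' (r *: e) by exact: (subspaceZ (orth_closed_subspace H W')).
have re1 : nrm H (r *: e) = 1 by rewrite nrmZ ger0_norm// mulVf// gt_eqF.
have Wd : orth H W' (r *: e - e2) by exact: (subspaceB (orth_closed_subspace H W')).
have d0 := orth_self Wd pe2.
have : nrm H (r *: x - x2) <= t * nrm H (r *: e - e2).
  apply: obl_le => //; first exact: (subspaceB clW (subspaceZ clW _ Wx)).
  rewrite (_ : _ - _ = r *: (e - x) - (e2 - x2)).
    have cVo := orth_closed_subspace H V'.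
    exact: (subspaceB cVo (subspaceZ cVo _ ex)).
  by rewrite scalerBr !opprB addrACA [RHS]addrACA [X in _ + X = _]addrC.
rewrite d0 mulr0 => xx; have {}xx : nrm H (r *: x - x2) = 0.
  by apply/eqP; rewrite eq_le xx nrm_ge0.
have : (l2norm (cfun x2) <= M%:E)%E.
  rewrite -AE -TE; apply: ereal_sup_ubound; exists (cfun (r *: e)) => //.
  by split; [exact: L2_cfun|rewrite l2norm_cfun re1].
by rewrite l2norm_cfun lee_fin -(nrm_dist0 xx) nrmZ ger0_norm// ler_pdivrMl// mulrC.
Qed.

Lemma aliasing_norm_tan : aliasing_norm V W = (tan (aperture V W))%:E.
Proof.
rewrite /aperture; case: asboolP => [W0|nW0].
  by rewrite aliasing_norm_trivial// /tan sin0 mul0r.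
have [w [Ww w0]] : exists w, W' w /\ 0 < nrm H w.
  apply: contrapT => nw; apply: nW0 => f Wf; have [w fw] := cfun_surj (WL2 Wf).
  rewrite fw; apply/ae_eq0_cfun; apply/eqP; apply: contrapT => /negP w0.
  apply: nw; exists w; split; first by rewrite /preimage /= -fw.
  by rewrite lt_def w0 nrm_ge0.
exact: aliasing_norm_nontrivial Ww w0.
Qed.
End aliasing.

End L2_Rk.

Theorem proposition4p6 (R : realType) (k : nat)
    (V W : set (Rk R k -> R[i])) (hV : FSI V) (hW : FSI W)
    (hVW : direct_sum_L2 V (orthocompl W)) :
  aliasing_norm V W = (tan (aperture V W))%:E.
Proof. exact: aliasing_norm_tan (FSI_Csubspace hV) (FSI_Csubspace hW) hVW. Qed.
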